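(* Let $p$ be an odd prime and let $t\ge 1$ be an integer. Define $$S=\Big\{\Big(ip^t+\tfrac{p^t+\varepsilon}{2},\ jp^t+\tfrac{p^t+\delta}{2}+kp^{t+1}\Big)\ \Big|\ \varepsilon,\delta\in\{1,-1\},\ 1\le i\le (p-1)/2,\ i\le j\le p-i-1,\ k\ge 0\Big\},$$ where $i,j,k$ range over the integers and the signs $\varepsilon,\delta$ are chosen independently. Suppose that $m,n$ are integers with $p^t\le m<p^{t+1}$ and $n\ge m$. Then the Jordan partition $\lambda(m,n,p)$ is standard if and only if $(m,n)\in S$.
   Context: Jordan partition: let $p$ be a prime, $K$ a field of characteristic $p$, and $G$ a cyclic group of order $q=p^\alpha$. There are exactly $q$ isomorphism classes of indecomposable $KG$-modules; let $V_1,\dots,V_q$ be representatives with $\dim V_i=i$. For positive integers $m\le n$ (with $\alpha$ chosen so that $n\le q$), the $KG$-module $V_m\otimes V_n$ (tensor product over $K$ with diagonal $G$-action) decomposes as a direct sum $V_{\lambda_1}\oplus\dots\oplus V_{\lambda_m}$ of exactly $m$ indecomposable modules with $\lambda_1\ge\dots\ge\lambda_m>0$; the $\lambda_i$ depend only on $m,n,p$. The Jordan partition is $\lambda(m,n,p)=(\lambda_1,\dots,\lambda_m)$, a partition of $mn$. The partition $\lambda(m,n,p)$ (with $m\le n$) is called standard if and only if $\lambda_i=m+n-2i+1$ for all $1\le i\le m$. *)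

(* Defs.v *)
From HB Require Import structures.
From mathcomp Require Import all_boot all_order all_fingroup all_algebra.
From mathcomp Require Import cyclic mxrepresentation character.
From mathcomp Require Import classical_sets.

Set Implicit Arguments.
Unset Strict Implicit.
Unset Printing Implicit Defensive.

Import GRing.Theory Num.Theory.
Local Open Scope ring_scope.

Definition mx_indecomposable (K : fieldType) (gT : finGroupType)
    (G : {group gT}) (d : nat) (rG : mx_representation K G d) : Prop :=
  (0 < d)%N /\
  forall U W : 'M[K]_d, mxmodule rG U -> mxmodule rG W ->
    (U + W :=: 1%:M)%MS -> mxdirect (U + W) -> U = 0 \/ W = 0.

(* Every part is at most #|G|: for G cyclic of order p ^ alpha in
   characteristic p there are no indecomposables of larger dimension, so only
   V 1, ..., V #|G| are meaningful. *)
Definition is_jordan_partition (K : fieldType) (gT : finGroupType)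
    (G : {group gT}) (V : forall d : nat, mx_representation K G d)
    (m n : nat) (lam : seq nat) : Prop :=
  [/\ sorted geq lam,
      all (fun d => 0 < d <= #|G|)%N lam
    & mx_rsim (prod_repr (V m) (V n))
              (\big[@dadd_grepr K gT G/grepr0]_(d <- lam) Representation (V d))].

(* Existence and uniqueness hold by the Krull-Schmidt theorem when G is cyclic
   of order p ^ alpha in characteristic p and the V d, for 0 < d <= #|G|, are
   indecomposable; the junk value is [::] when no such partition exists. *)
Definition jordan_partition (K : fieldType) (gT : finGroupType)
    (G : {group gT}) (V : forall d : nat, mx_representation K G d)
    (m n : nat) : seq nat :=
  xget [::] [set lam | is_jordan_partition V m n lam]%classic.

(* Parts are numbered from 1, whereas nth counts from 0; for i <= m the
   subtraction is exact. *)
Definition standard_partition (m n : nat) (lam : seq nat) : Prop :=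
  forall i : nat, (1 <= i <= m)%N ->
    nth 0%N lam i.-1 = (m + n - 2 * i + 1)%N.

(* For p odd both divisions by 2 are exact. *)
Definition standard_pairs (p t : nat) : set (int * int) :=
  [set mn : int * int | exists eps delta i j k : int,
    [/\ eps = 1 \/ eps = -1,
        delta = 1 \/ delta = -1,
        1 <= i <= ((p%:Z - 1) %/ 2)%Z,
        i <= j <= p%:Z - i - 1
      & 0 <= k /\
        mn = (i * p%:Z ^+ t + ((p%:Z ^+ t + eps) %/ 2)%Z,
              j * p%:Z ^+ t + ((p%:Z ^+ t + delta) %/ 2)%Z
                + k * p%:Z ^+ t.+1)]]%classic.

(* Main.v *)
Require Import Defs.
From HB Require Import structures.
From mathcomp Require Import all_boot all_order all_fingroup all_algebra.
From mathcomp Require Import cyclic mxrepresentation character.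
From mathcomp Require Import classical_sets zify ring.

Set Implicit Arguments.
Unset Strict Implicit.
Unset Printing Implicit Defensive.

Import GRing.Theory Num.Theory.

(** Let g generate G. On [V m] the operator [g - 1] is a single nilpotent block, and on
    [V m (x) V n] the operator [g (x) g - 1] is conjugate to multiplication by [x + y] on
    the graded algebra [A = K[x, y] / (x ^ m, y ^ n)]. The Jordan partition is standard iff,
    for every [d < m], multiplication by [(x + y) ^ (m + n - 2 - 2 d)] is bijective from
    degree [d] to degree [m + n - 2 - d]: if one of these maps is singular, then that power
    has too small a rank; if all are bijective, then there are homogeneous vectors, one in
    each degree [d < m], killed by [(x + y) ^ (m + n - 1 - 2 d)] and generating [A] over
    [K[x + y]].

    The determinant of the [d]-th map is MacMahon's number of plane partitions in a box of
    size [(m - r) * (n - r) * r], [r = d + 1]. Its p-adic valuation is a sum over the powers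
    [q] of [p] of nonnegative terms built from integer parts, so all determinants are prime
    to [p] iff each term vanishes for all [r]. Comparing consecutive [r] gives a condition on
    [m] and [n] modulo [q]: for [q <= m] both residues are [(q - 1) / 2] or [(q + 1) / 2], and
    for [q > m] there is a condition on [m - 1] and the residue of [n - 1]. *)

(** * Integer parts and the digits of [m] and [n] *)

(* Equality of the exponents of the [q]-th cyclotomic polynomial in two consecutive
   boxes, of sizes [(m - r) * (n - r) * r] and [(m - r - 1) * (n - r - 1) * (r + 1)];
   for [r < m <= n] the subtractions are exact. *)
Definition balanced (q m n r : nat) : Prop :=
  r %/ q + (m + n - 2 * r - 2) %/ q + (m + n - 2 * r - 1) %/ q =
  (m + n - r - 1) %/ q + (m - r - 1) %/ q + (n - r - 1) %/ q.

Section IntegerWindows.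

Local Open Scope ring_scope.

Lemma divz_window (q x : int) : 0 < q -> - (2 * q) <= x < 2 * q ->
  [\/ (x %/ q)%Z = -2 /\ - (2 * q) <= x < - q, (x %/ q)%Z = -1 /\ - q <= x < 0,
      (x %/ q)%Z = 0 /\ 0 <= x < q | (x %/ q)%Z = 1 /\ q <= x < 2 * q].
Proof.
move=> q0 xb; have := divz_eq x q; have := ltz_pmod x q0.
have := modz_ge0 x (lt0r_neq0 q0).
set u := (x %/ q)%Z; set v := (x %% q)%Z => v0 vq xE.
have : [|| u == -2, u == -1, u == 0 | u == 1] by nia.
case/or4P => /eqP uE; rewrite uE in xE *.
- by constructor 1; lia.
- by constructor 2; lia.
- by constructor 3; lia.
by constructor 4; lia.
Qed.

Definition zbalanced (q M N r : int) : Prop :=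
  divz r q + divz (M + N - 2 * r) q + divz (M + N + 1 - 2 * r) q =
  divz (M + N + 1 - r) q + divz (M - r) q + divz (N - r) q.

Lemma balancedE q m n r : (r < m)%N -> (m <= n)%N ->
  balanced q m n r <-> zbalanced q%:Z (m%:Z - 1) (n%:Z - 1) r%:Z.
Proof.
move=> rm mn; rewrite /zbalanced.
have -> : m%:Z - 1 + (n%:Z - 1) - 2 * r%:Z = (m + n - 2 * r - 2)%N%:Z by lia.
have -> : m%:Z - 1 + (n%:Z - 1) + 1 - 2 * r%:Z = (m + n - 2 * r - 1)%N%:Z by lia.
have -> : m%:Z - 1 + (n%:Z - 1) + 1 - r%:Z = (m + n - r - 1)%N%:Z by lia.
have -> : m%:Z - 1 - r%:Z = (m - r - 1)%N%:Z by lia.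
have -> : n%:Z - 1 - r%:Z = (n - r - 1)%N%:Z by lia.
rewrite !divz_nat /balanced; split; last by move=> /eqP; rewrite -!PoszD eqz_nat => /eqP.
by move=> h; rewrite -!PoszD h.
Qed.

Lemma zbalanced_shift (q M N r a b c : int) : q != 0 ->
  zbalanced q (a * q + M) (b * q + N) (c * q + r) <-> zbalanced q M N r.
Proof.
move=> q0; rewrite /zbalanced.
have -> : a * q + M + (b * q + N) - 2 * (c * q + r) =
  (a + b - 2 * c) * q + (M + N - 2 * r) by lia.
have -> : a * q + M + (b * q + N) + 1 - 2 * (c * q + r) =
  (a + b - 2 * c) * q + (M + N + 1 - 2 * r) by lia.
have -> : a * q + M + (b * q + N) + 1 - (c * q + r) =
  (a + b - c) * q + (M + N + 1 - r) by lia.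
have -> : a * q + M - (c * q + r) = (a - c) * q + (M - r) by lia.
have -> : b * q + N - (c * q + r) = (b - c) * q + (N - r) by lia.
rewrite !divzMDl //; move: (divz r q) (divz (M + N - 2 * r) q).
move: (divz (M + N + 1 - 2 * r) q) (divz (M + N + 1 - r) q) (divz (M - r) q) (divz (N - r) q).
by move=> *; split; lia.
Qed.

Ltac windows q0 :=
  repeat match goal with |- context [divz ?x ?q] =>
    let H := fresh in
    (have H : - (2 * q) <= x < 2 * q by lia);
    move: (divz_window q0 H) => {H}; move: (divz x q) => ? [] [? ?]; subst;
      try (exfalso; lia)
  end.

Lemma zbalanced0 (q M N : int) : 0 < q -> 0 <= M < q -> 0 <= N < q ->
  zbalanced q M N 0 -> M + N < q.
Proof. by move=> q0 hM hN; rewrite /zbalanced; windows q0; lia. Qed.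

Lemma zbalanced_le (q M N r : int) : 0 < q -> 0 <= M -> 0 <= N -> M + N < q ->
  0 <= r -> r <= M -> M <= N + 1 -> zbalanced q M N r.
Proof. by move=> q0 *; rewrite /zbalanced; windows q0; lia. Qed.

Lemma zbalanced_next (q M N : int) : 0 < q -> 0 <= M < q -> 0 <= N < q -> M + N < q ->
  M + 1 < q -> zbalanced q M N (M + 1) -> N <= M + 1.
Proof. by move=> q0 hM hN s hM1; rewrite /zbalanced; windows q0; lia. Qed.

Lemma zbalanced_last (q M N : int) : 0 < q -> 0 <= M < q -> 0 <= N < q -> M + N < q ->
  zbalanced q M N (q - 1) -> q <= M + N + 3.
Proof. by move=> q0 hM hN s; rewrite /zbalanced; windows q0; lia. Qed.

Lemma zbalanced_sym (q M N r : int) : zbalanced q M N r <-> zbalanced q N M r.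
Proof.
rewrite /zbalanced [N + M]addrC.
by split=> h; rewrite -!addrA [X in _ = _ + X]addrC !addrA.
Qed.

Lemma zbalanced_mid (q M N r : int) : 2 < q -> 2 * M = q - 1 \/ 2 * M = q - 3 ->
  2 * N = q - 1 \/ 2 * N = q - 3 -> 0 <= r < q -> zbalanced q M N r.
Proof.
move=> q2 hM hN hr; have q0 : 0 < q by lia.
by rewrite /zbalanced; windows q0; lia.
Qed.

End IntegerWindows.

Lemma balanced_mod q m n r : (0 < q)%N -> (r < m)%N -> (m <= n)%N ->
  balanced q m n r <->
  zbalanced q%:Z (m.-1 %% q)%N%:Z (n.-1 %% q)%N%:Z (r %% q)%N%:Z.
Proof.
move=> q0 rm mn; rewrite balancedE //.
have e x : ((x %/ q)%N%:Z * q%:Z + (x %% q)%N%:Z = x%:Z)%R.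
  by rewrite -PoszM -PoszD -divn_eq.
have q0' : (q%:Z != 0)%R by lia.
rewrite -(zbalanced_shift (Posz (m.-1 %% q)) (Posz (n.-1 %% q)) (Posz (r %% q))
  (Posz (m.-1 %/ q)) (Posz (n.-1 %/ q)) (Posz (r %/ q)) q0').
rewrite !e.
by have [-> ->] : (m%:Z - 1 = m.-1%:Z /\ n%:Z - 1 = n.-1%:Z)%R by lia.
Qed.

Definition near_half (q x : nat) : Prop :=
  2 * (x %% q) = q.-1 \/ 2 * (x %% q) = q.+1.

Lemma near_half_pred q x : (2 < q)%N -> (0 < x)%N -> near_half q x <->
  2 * (x.-1 %% q) = q.-1 \/ 2 * (x.-1 %% q) = q - 3.
Proof.
move=> q2 x0; rewrite /near_half; have := ltn_pmod x.-1 (ltnW (ltnW q2)).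
have [lt|] := ltnP (x.-1 %% q).+1 q.
  suff -> : x %% q = (x.-1 %% q).+1 by lia.
  by rewrite -[in LHS](prednK x0) -[_.-1.+1]addn1 -modnDml addn1 modn_small.
move=> ge lt; have e : (x.-1 %% q).+1 = q by lia.
suff -> : x %% q = 0 by lia.
by rewrite -[in LHS](prednK x0) -[_.-1.+1]addn1 -modnDml addn1 e modnn.
Qed.

Lemma balanced_large q m n : odd q -> (2 < q)%N -> (q <= m)%N -> (m <= n)%N ->
  (forall r, (r < m)%N -> balanced q m n r) <-> near_half q m /\ near_half q n.
Proof.
move=> oq q2 qm mn; have q0 : (0 < q)%N by lia.
rewrite !near_half_pred //; try lia.
have := ltn_pmod m.-1 q0; have := ltn_pmod n.-1 q0.
set M := m.-1 %% q; set N := n.-1 %% q => hN hM; split; last first.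
  move=> h r rm; rewrite balanced_mod //.
  rewrite -/M -/N; have := ltn_pmod r q0; move: (r %% q) => r' hr.
  clearbody M N; clear -oq q2 h hr.
  by apply: zbalanced_mid; lia.
move=> h.
have {}h r : (r < q)%N -> zbalanced q M N r.
  by move=> rq; rewrite -[X in zbalanced _ _ _ (Posz X)](modn_small rq) -balanced_mod //;
    [apply: h|]; lia.
clearbody M N; clear -oq q2 hM hN q0 h.
have h0 := zbalanced0 _ _ _ (h 0 q0).
have h1 : (q <= M + N + 3)%N.
  have := @zbalanced_last q M N; have -> : (q%:Z - 1 = q.-1%:Z)%R by lia.
  by move=> /(_ _ _ _ _ (h q.-1 _)); lia.
have h2 : (M.+1 < q -> N <= M.+1)%N.
  move=> lt; have := @zbalanced_next q M N.
  have -> : (M%:Z + 1 = M.+1%:Z)%R by lia.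
  by move=> /(_ _ _ _ _ _ (h M.+1 _)); lia.
have h3 : (N.+1 < q -> M <= N.+1)%N.
  move=> lt; have := @zbalanced_next q N M.
  have -> : (N%:Z + 1 = N.+1%:Z)%R by lia.
  by move=> /(_ _ _ _ _ _ ((zbalanced_sym _ _ _ _).1 (h N.+1 _))); lia.
lia.
Qed.

Lemma balanced_small q m n : (0 < m)%N -> (m <= q)%N -> (m <= n)%N ->
  (forall r, (r < m)%N -> balanced q m n r) <->
  (m.-1 + n.-1 %% q < q)%N /\ (m.-1 <= (n.-1 %% q).+1)%N.
Proof.
move=> m0 mq mn; have q0 : (0 < q)%N by lia.
have := ltn_pmod n.-1 q0; set N := n.-1 %% q => hN; split; last first.
  move=> [h1 h2] r rm; rewrite balanced_mod // -/N !modn_small; try lia.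
  by apply: zbalanced_le; lia.
move=> h.
have {}h r : (r < m)%N -> zbalanced q m.-1 N r.
  by move=> rm; have := h r rm; rewrite balanced_mod // -/N !(@modn_small _ q) //; lia.
have h0 := zbalanced0 _ _ _ (h 0 m0).
suff h3 : (N.+1 < m -> m.-1 <= N.+1)%N by lia.
move=> lt; have := @zbalanced_next q N m.-1.
have -> : (N%:Z + 1 = N.+1%:Z)%R by lia.
by move=> /(_ _ _ _ _ _ ((zbalanced_sym _ _ _ _).1 (h N.+1 _))); lia.
Qed.

Definition floor_sum (q y r : nat) : nat := \sum_(k < r) (y + k) %/ q.

Lemma floor_sumSr q y r : floor_sum q y r.+1 = floor_sum q y r + (y + r) %/ q.
Proof. by rewrite /floor_sum big_ord_recr. Qed.

Lemma floor_sum_cat q y r s :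
  floor_sum q y (r + s) = floor_sum q y r + floor_sum q (y + r) s.
Proof.
elim: s => [|s IH]; first by rewrite addn0 /floor_sum big_ord0 addn0.
by rewrite addnS !floor_sumSr IH !addnA.
Qed.

Lemma floor_sumSl q y r : floor_sum q y r.+1 = y %/ q + floor_sum q y.+1 r.
Proof. by rewrite -add1n floor_sum_cat addn1 /floor_sum big_ord1 addn0. Qed.

Lemma floor_sum_shift q y c r : 0 < q ->
  floor_sum q (c * q + y) r = c * r + floor_sum q y r.
Proof.
move=> q0; elim: r => [|r IH]; first by rewrite /floor_sum !big_ord0 muln0.
by rewrite !floor_sumSr IH -[c * q + y + r]addnA divnMDl //; lia.
Qed.

Lemma floor_sum_period q y : 0 < q -> floor_sum q y q = y.
Proof.
move=> q0; elim: y => [|y IH].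
  by rewrite /floor_sum big1 // => k _; rewrite add0n divn_small.
have := floor_sumSl q y q; rewrite floor_sumSr IH -[y + q]addnC -[X in X + y]mul1n.
by rewrite divnMDl //; lia.
Qed.

Lemma floor_sum_window q y r : r <= q -> y < 2 * q ->
  floor_sum q y r = if q <= y then r + (y + r - 2 * q) else y + r - q.
Proof.
move=> rq yq; elim: r rq => [|r IH] rq.
  by rewrite /floor_sum big_ord0; case: leqP; lia.
rewrite floor_sumSr IH; last by lia.
have q0 : 0 < q by lia.
have := divn_eq (y + r) q; have := ltn_pmod (y + r) q0.
move: ((y + r) %/ q) ((y + r) %% q) => d e eq E.
have /or3P[] : [|| d == 0, d == 1 | d == 2] by nia.
all: by move=> /eqP dE; rewrite dE in E *; case: leqP; lia.
Qed.

(* The exponent of the [q]-th cyclotomic polynomial in the q-analogue of MacMahon's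
   count of plane partitions in an [a * b * r] box. *)
Lemma floor_sum_box q a b r : 0 < q ->
  floor_sum q a r + floor_sum q b r <= floor_sum q 0 r + floor_sum q (a + b) r.
Proof.
move=> q0; elim/ltn_ind: r => r IH.
have [rq|qr] := ltnP r q; last first.
  have {}IH := IH (r - q) ltac:(lia).
  rewrite -(subnK qr) !floor_sum_cat !floor_sum_period //; lia.
rewrite (divn_eq a q) (divn_eq b q).
have := ltn_pmod a q0; have := ltn_pmod b q0.
move: (a %/ q) (a %% q) (b %/ q) (b %% q) => A a' B b' hb ha.
have -> : A * q + a' + (B * q + b') = (A + B) * q + (a' + b') by lia.
rewrite !floor_sum_shift // !floor_sum_window; try lia.
by case: (leqP q 0); case: (leqP q a'); case: (leqP q b'); case: (leqP q (a' + b')); lia.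
Qed.

Lemma floor_sum_balanced q m n : 0 < q -> m <= n ->
  (forall r, r < m -> balanced q m n r) <->
  (forall r, r <= m -> floor_sum q (m - r) r + floor_sum q (n - r) r =
                       floor_sum q 0 r + floor_sum q (m - r + (n - r)) r).
Proof.
move=> q0 mn.
pose F r := floor_sum q 0 r + floor_sum q (m - r + (n - r)) r.
pose H r := floor_sum q (m - r) r + floor_sum q (n - r) r.
have step r : r < m -> (H r.+1 + F r = F r.+1 + H r) <-> balanced q m n r.
  move=> rm; rewrite /F /H /balanced !floor_sumSr add0n.
  have e : m - r + (n - r) = (m - r.+1 + (n - r.+1)).+2 by lia.
  have := floor_sumSl q (m - r.+1 + (n - r.+1)).+1 r.
  have := floor_sumSl q (m - r.+1 + (n - r.+1)) r.+1.
  rewrite !floor_sumSr -e.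
  have := floor_sumSl q (m - r.+1) r; rewrite floor_sumSr.
  have := floor_sumSl q (n - r.+1) r; rewrite floor_sumSr.
  have -> : (m - r.+1).+1 = m - r by lia.
  have -> : (n - r.+1).+1 = n - r by lia.
  have -> : m + n - 2 * r - 2 = m - r.+1 + (n - r.+1) by lia.
  have -> : m + n - 2 * r - 1 = (m - r.+1 + (n - r.+1)).+1 by lia.
  have -> : m + n - r - 1 = (m - r.+1 + (n - r.+1)).+1 + r by lia.
  have -> : m - r - 1 = m - r.+1 by lia.
  have -> : n - r - 1 = n - r.+1 by lia.
  rewrite !addSn !addnS; clear.
  repeat match goal with |- context [?x %/ ?y] => move: (x %/ y) => ? end.
  by lia.
split=> [bal r|hF r rm]; last first.
  have e s : s <= m -> H s = F s by exact: hF.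
  by apply/(step _ rm); rewrite !e //; lia.
elim: r => [|r IH] rm; first by rewrite /floor_sum !big_ord0.
have := (step r rm).2 (bal r rm); have := IH (ltnW rm).
rewrite -/(H r) -/(F r) -/(H r.+1) -/(F r.+1); lia.
Qed.

Definition fact_run (y r : nat) : nat := \prod_(k < r) (y + k)`!.

Lemma fact_run_gt0 y r : 0 < fact_run y r.
Proof. by rewrite /fact_run prodn_gt0 // => k; apply: fact_gt0. Qed.

Lemma logn_fact_widen p x L : prime p -> x < L ->
  logn p x`! = \sum_(1 <= l < L) x %/ p ^ l.
Proof.
move=> pp xL; rewrite logn_fact // [RHS](big_cat_nat (n := x.+1)) //=.
rewrite [X in _ + X]big_nat_cond [X in _ + X]big1 ?addn0 // => l /andP[/andP[xl _] _].
by rewrite divn_small // (leq_trans (ltn_expl x (prime_gt1 pp))) // leq_pexp2l ?prime_gt0 // ltnW.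
Qed.

Lemma logn_fact_run p y r L : prime p -> y + r <= L ->
  logn p (fact_run y r) = \sum_(1 <= l < L) floor_sum (p ^ l) y r.
Proof.
move=> pp; elim: r => [|r IH] yrL.
  rewrite /fact_run big_ord0 logn1 big1 // => l _.
  by rewrite /floor_sum big_ord0.
rewrite /fact_run big_ord_recr /= -/(fact_run y r) lognM ?fact_gt0 ?fact_run_gt0 //.
rewrite IH; last by lia.
rewrite (@logn_fact_widen p _ L) //; last by lia.
by rewrite -big_split; apply: eq_bigr => l _; rewrite floor_sumSr.
Qed.

Lemma eq_from_leq_sum (I : eqType) (s : seq I) (F H : I -> nat) :
  (forall i, F i <= H i) -> \sum_(i <- s) F i = \sum_(i <- s) H i ->
  {in s, F =1 H}.
Proof.
move=> leFH; elim: s => [|i s IH] //; rewrite !big_cons => e.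
have le_s : \sum_(i <- s) F i <= \sum_(i <- s) H i by apply: leq_sum.
have le_i := leFH i; move=> j; rewrite inE => /predU1P[->|js]; first by lia.
by apply: IH => //; lia.
Qed.

Lemma logn_box p a b r L : prime p -> a + b + r <= L ->
  logn p (fact_run a r * fact_run b r) = logn p (fact_run 0 r * fact_run (a + b) r) <->
  forall l, 1 <= l < L -> floor_sum (p ^ l) a r + floor_sum (p ^ l) b r =
    floor_sum (p ^ l) 0 r + floor_sum (p ^ l) (a + b) r.
Proof.
move=> pp hL; rewrite !lognM ?fact_run_gt0 // !(@logn_fact_run p _ _ L) //; try lia.
rewrite -!big_split /=; split=> [e l hl|e]; last exact: eq_big_nat.
apply: (eq_from_leq_sum _ e); last by rewrite mem_index_iota.
by move=> k; apply: floor_sum_box; rewrite expn_gt0 prime_gt0.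
Qed.

Lemma logn_boxes_balanced p m n : prime p -> 0 < m -> m <= n ->
  (forall r, r <= m ->
    logn p (fact_run (m - r) r * fact_run (n - r) r) =
    logn p (fact_run 0 r * fact_run (m - r + (n - r)) r)) <->
  (forall l r, 1 <= l < m + n -> r < m -> balanced (p ^ l) m n r).
Proof.
move=> pp m0 mn.
have q0 l : 0 < p ^ l by rewrite expn_gt0 prime_gt0.
have hL r : r <= m -> m - r + (n - r) + r <= m + n by lia.
split=> [h l r hl|h r rm].
  move: r; apply/(floor_sum_balanced (q0 l) mn) => r rm.
  exact: (logn_box pp (hL r rm)).1 (h r rm) l hl.
apply/(logn_box pp (hL r rm)) => l hl.
by apply: (floor_sum_balanced (q0 l) mn).1 rm => s; apply: h.
Qed.

Lemma near_half_dvd q s x : odd (q * s) -> 1 < q -> near_half (q * s) x -> near_half q x.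
Proof.
move=> oqs q1; rewrite /near_half.
have -> : x %% q = (x %% (q * s)) %% q by rewrite modn_dvdm // dvdn_mulr.
move: oqs; rewrite oddM => /andP[oq os]; move: (x %% _) => y.
have [u sE] : exists u, s = 2 * u + 1 by exists (s./2); lia.
have [v qE] : exists v, q = 2 * v + 1 by exists (q./2); lia.
have : forall z, z < q -> (u * q + z) %% q = z.
  by move=> z zq; rewrite modnMDl modn_small.
move=> e [yE|yE].
  have -> : y = u * q + v by nia.
  by rewrite e; lia.
have -> : y = u * q + v.+1 by nia.
by rewrite e; lia.
Qed.

Lemma boxes_balanced_iff p t m n : prime p -> odd p -> 1 <= t ->
  p ^ t <= m < p ^ t.+1 -> m <= n ->
  (forall l r, 1 <= l < m + n -> r < m -> balanced (p ^ l) m n r) <->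
  [/\ near_half (p ^ t) m, near_half (p ^ t) n,
      m.-1 + n.-1 %% p ^ t.+1 < p ^ t.+1 & m.-1 <= (n.-1 %% p ^ t.+1).+1].
Proof.
move=> pp op t1 /andP[tm mt] mn.
have p2 : 2 < p by have := prime_gt1 pp; case: p op {pp tm mt} => [|[|[|p]]].
have p2X l : 1 <= l -> 2 < p ^ l.
  by move=> l1; apply: leq_trans p2 _; rewrite -{1}[p]expn1 leq_pexp2l //; lia.
have oX l : odd (p ^ l) by rewrite oddX op orbT.
have tlt : t < p ^ t by rewrite ltn_expl //; lia.
have := p2X t t1 => p2t.
split=> [h|[hm hn h1 h2] l r hl rm].
  have [hm hn] := (balanced_large (oX t) p2t tm mn).1 (fun r => h t r ltac:(lia)).
  have [h1 h2] := (balanced_small (ltac:(lia) : 0 < m) (ltnW mt) mn).1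
    (fun r => h t.+1 r ltac:(lia)).
  by split.
have [lt|tl] := leqP l t.
  move: r rm; apply/balanced_large => //.
  - by apply: p2X; lia.
  - by apply: leq_trans tm; rewrite leq_pexp2l //; lia.
  have tE : p ^ t = p ^ l * p ^ (t - l) by rewrite -expnD subnKC.
  have pl2 := p2X l ltac:(lia).
  by split; apply: (@near_half_dvd _ (p ^ (t - l))); rewrite -?tE //; lia.
move: r rm; apply/balanced_small => //; try lia.
  by apply: (leq_trans (ltnW mt)); rewrite leq_pexp2l //; lia.
have lE : p ^ l = p ^ t.+1 * p ^ (l - t.+1) by rewrite -expnD subnKC.
have := modn_dvdm n.-1 (dvdn_mulr (p ^ (l - t.+1)) (dvdnn (p ^ t.+1))).
have : n.-1 %% p ^ l < p ^ l by rewrite ltn_pmod // expn_gt0; lia.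
rewrite -lE; move: (n.-1 %% p ^ l) => N hN NE.
have := divn_eq N (p ^ t.+1); rewrite NE.
have : N %/ p ^ t.+1 < p ^ (l - t.+1) by rewrite ltn_divLR ?expn_gt0 1?mulnC -?lE //; lia.
move: (N %/ _) (n.-1 %% _) h1 h2 => d e h1 h2 hd E.
have ? : 0 < p ^ t.+1 by rewrite expn_gt0; lia.
split; last by nia.
by rewrite lE E; nia.
Qed.

Lemma pred_modn Q n : 0 < n %% Q -> n.-1 %% Q = (n %% Q).-1.
Proof.
move=> n0; have [->|Q0] := posnP Q; first by rewrite !modn0.
rewrite {1}(divn_eq n Q) -[in LHS](prednK n0) addnS /= modnMDl modn_small //.
by have := ltn_pmod n Q0; lia.
Qed.

Lemma near_halfE q x : odd q -> near_half q x <->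
  exists e : bool, x %% q = q./2 + e.
Proof.
move=> oq; rewrite /near_half; split=> [[] h|[e h]].
- by exists false; lia.
- by exists true; lia.
by case: e h => h; [right|left]; lia.
Qed.

Lemma standard_pairsE p t m n : prime p -> odd p -> 1 <= t ->
  p ^ t <= m < p ^ t.+1 -> m <= n ->
  standard_pairs p t (m%:Z, n%:Z)%R <->
  [/\ near_half (p ^ t) m, near_half (p ^ t) n,
      m.-1 + n.-1 %% p ^ t.+1 < p ^ t.+1 & m.-1 <= (n.-1 %% p ^ t.+1).+1].
Proof.
move=> pp op t1 /andP[tm mt] mn.
have p2 : 2 < p by have := prime_gt1 pp; case: p op {pp tm mt} => [|[|[|p]]].
have q2 : 2 < p ^ t by apply: leq_trans p2 _; rewrite -{1}[p]expn1 leq_pexp2l //; lia.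
have oq : odd (p ^ t) by rewrite oddX op orbT.
have hE x := near_halfE x oq.
rewrite /standard_pairs /= expnS in mt *.
have -> : (p%:Z ^+ t.+1 = p%:Z * (p ^ t)%N%:Z :> int)%R.
  by rewrite exprS; congr (_ * _)%R; rewrite -[Posz p]natz -natrX natz.
have -> : (p%:Z ^+ t = (p ^ t)%N%:Z :> int)%R by rewrite -[Posz p]natz -natrX natz.
move: (p ^ t) tm mt q2 oq hE => q tm mt q2 oq hE.
pose h := q./2; have qE : q = 2 * h + 1 by rewrite /h; lia.
have half1 (e : bool) : (((q%:Z + (if e then 1 else -1)) %/ 2)%Z = (h + e)%N%:Z)%R.
  by case: e; lia.
split.
  move=> [eps [delta [i [j [k [epsE deltaE /andP[i1 ip] /andP[ij jp] [k0 [mE nE]]]]]]]].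
  have [e eE] : exists e : bool, eps = (if e then 1 else -1)%R.
    by case: epsE => ->; [exists true|exists false].
  have [d dE] : exists d : bool, delta = (if d then 1 else -1)%R.
    by case: deltaE => ->; [exists true|exists false].
  rewrite eE dE !half1 in mE nE; move=> {epsE deltaE eE dE eps delta}.
  case: i i1 ip ij jp mE => // i i1 ip ij jp mE.
  case: j ij jp nE => [j|j] ij jp nE; last by lia.
  case: k k0 nE => [k|//] k0 nE.
  have {}mE : m = i * q + (h + e) by lia.
  have {}nE : n = k * (p * q) + (j * q + (h + d)) by lia.
  have hd : h + d < q by lia.
  have he : h + e < q by lia.
  have ijp : (i <= j) /\ i + j <= p.-1 by lia.
  have hq1 : (i + j + 1) * q <= p * q by rewrite leq_mul2r; lia.
  have hq2 : i * q <= j * q by rewrite leq_mul2r ijp.1 orbT.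
  have n1 : n %% (p * q) = j * q + (h + d).
    by rewrite nE modnMDl modn_small //; clear -hq1 hq2 hd; lia.
  have n1' : n.-1 %% (p * q) = (j * q + (h + d)).-1.
    by rewrite pred_modn n1 //; clear -qE q2; lia.
  split.
  - by apply/hE; exists e; rewrite -/h mE modnMDl modn_small.
  - by apply/hE; exists d; rewrite -/h -(modn_dvdm n (dvdn_mull p (dvdnn q))) n1 modnMDl modn_small.
  - by rewrite n1' mE; clear -hq1 hq2 hd he qE q2; case: (e) (d) he hd => [] []; lia.
  by rewrite n1' mE; clear -hq1 hq2 hd he qE q2; case: (e) (d) he hd => [] []; lia.
move=> [/hE[e mE] /hE[d nE] h1 h2]; rewrite -/h in mE nE.
set n1 := n %% (p * q).
have n1E : n1 %% q = h + d by rewrite /n1 modn_dvdm // dvdn_mull.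
have n1_gt0 : 0 < n1 by rewrite lt0n; apply/eqP => n10; move: n1E; rewrite n10 mod0n; clear -qE q2; lia.
rewrite (pred_modn n1_gt0) -/n1 in h1 h2.
have EQm := divn_eq m q; rewrite mE in EQm.
have EQn1 := divn_eq n1 q; rewrite n1E in EQn1.
have EQn := divn_eq n (p * q); rewrite -/n1 in EQn.
exists (if e then 1 else -1)%R, (if d then 1 else -1)%R.
exists (Posz (m %/ q)), (Posz (n1 %/ q)), (Posz (n %/ (p * q))); rewrite !half1.
have i1 : 1 <= m %/ q by rewrite divn_gt0 //; lia.
move: (m %/ q) (n1 %/ q) (n %/ (p * q)) i1 EQm EQn1 EQn => i j k i1 EQm EQn1 EQn.
rewrite {1}EQm EQn1 in h1; rewrite {1}EQm EQn1 in h2.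
have ijp : i + j < p.
  clear -h1 qE q2.
  rewrite ltnNge; apply/negP => /(leq_mul (leqnn q)); rewrite mulnDr [q * p]mulnC.
  by rewrite ![q * _]mulnC; lia.
have ij : i <= j.
  by clear -h2 qE q2; rewrite leqNgt; apply/negP => /(leq_mul (leqnn q)); rewrite mulnS ![q * _]mulnC; lia.
have ip : 2 * i < p by clear -ij ijp; lia.
clear -i1 ip ij ijp EQm EQn1 EQn p2 op; clearbody n1.
split; try lia.
- by case: (e); [left|right].
- by case: (d); [left|right].
- by split; [lia|congr (_, _); lia].
Qed.

(** * The plane partition determinant *)

Local Open Scope ring_scope.

(* In [K[x, y] / (x ^ (a + r), y ^ (b + r))] this is the matrix of multiplication by
   [(x + y) ^ (a + b)] from degree [r - 1] to degree [a + b + r - 1], in the monomial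
   bases [x ^ i y ^ (r - 1 - i)] and [x ^ (a + j) y ^ (b + r - 1 - j)]. *)
Definition box_mx (R : pzRingType) (a b r : nat) : 'M[R]_r :=
  \matrix_(i < r, j < r) (if (i <= a + j)%N then 'C(a + b, a + j - i) else 0)%:R.

(* The matrix is the coefficient matrix of [P] times a Vandermonde matrix, and the
   Vandermonde determinant is translation invariant. *)
Lemma det_horner_translate (R : comNzRingType) r (P : 'I_r -> {poly R}) (c : R) :
    (forall i, size (P i) <= r)%N ->
  \det (\matrix_(i, j < r) (P i).[j%:R + c]) = \det (\matrix_(i, j < r) (P i).[j%:R]).
Proof.
move=> sP.
have E (x : 'rV[R]_r) : \matrix_(i, j < r) (P i).[x 0 j] =
    (\matrix_(i, k < r) (P i)`_k) *m Vandermonde r x.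
  apply/matrixP => i j; rewrite !mxE (horner_coef_wide _ (sP i)).
  by apply: eq_bigr => k _; rewrite !mxE.
have := E (\row_j (j%:R + c)); have := E (\row_j j%:R).
under eq_mx do rewrite mxE; move=> ->.
under eq_mx do rewrite mxE; move=> ->.
rewrite !det_mulmx !det_Vandermonde; congr (_ * _).
by apply: eq_bigr => i _; apply: eq_bigr => j _; rewrite !mxE; ring.
Qed.

Lemma prod_ffact (R : pzRingType) n m :
  \prod_(s < m) (n%:R - s%:R) = (n ^_ m)%:R :> R.
Proof.
elim: m => [|m IH]; first by rewrite big_ord0 ffactn0.
rewrite big_ord_recr /= IH ffactnSr natrM.
have [mn|nm] := leqP m n; first by rewrite natrB.
by rewrite ffact_small // !mul0r.
Qed.

Lemma size_prod_linear (R : nzRingType) m (F : 'I_m -> {poly R}) :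
  (forall s, size (F s) <= 2)%N -> (size (\prod_s F s)%R <= m.+1)%N.
Proof.
move=> sF; apply: leq_trans (size_poly_prod_leq _ _) _.
rewrite cardT size_enum_ord leq_subLR.
have : (\sum_s size (F s) <= \sum_(s < m) 2)%N by apply: leq_sum.
by rewrite sum_nat_const card_ord; lia.
Qed.

(* Up to factorials, column [j] of the box matrix lists the values at [j] of the
   polynomials [P i] below; translating the points by [- a] makes the matrix triangular. *)
Lemma det_box_mx a b r :
  \det (box_mx int a b r) * (fact_run a r * fact_run b r)%:R =
  (fact_run 0 r * fact_run (a + b) r)%:R.
Proof.
pose P (i : 'I_r) : {poly int} :=
  (\prod_(s < i) ('X + (a%:R - s%:R)%:P)) *
  (\prod_(s < r.-1 - i) ((b%:R + r.-1%:R - s%:R)%:P - 'X)).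
have PE (i : 'I_r) x : (P i).[x] = (\prod_(s < i) (x + a%:R - s%:R)) *
  (\prod_(s < r.-1 - i) (b%:R + r.-1%:R - x - s%:R)).
  rewrite hornerM !horner_prod; congr (_ * _); apply: eq_bigr => s _.
    by rewrite hornerD hornerX hornerC addrA.
  by rewrite hornerD hornerN hornerX hornerC; ring.
have sP (i : 'I_r) : (size (P i) <= r)%N.
  apply: leq_trans (size_polyMleq _ _) _.
  have ir := ltn_ord i.
  set A := \prod_(s < i) _; set B := \prod_(s < r.-1 - i) _.
  have sA : (size A <= i.+1)%N.
    by apply: size_prod_linear => s; rewrite size_XaddC.
  have sB : (size B <= (r.-1 - i).+1)%N.
    apply: size_prod_linear => s; rewrite -size_polyN opprB size_XsubC //.
  apply: (@leq_trans (i.+1 + (r.-1 - i).+1).-1); last by lia.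
  by have := leq_sub2r 1 (leq_add sA sB); rewrite !(subn1 (_ + _)).
have revE y : fact_run y r = (\prod_(k < r) (y + r.-1 - k)`!)%N.
  rewrite /fact_run (reindex_inj rev_ord_inj) /=; apply: eq_bigr => k _.
  by congr (_`!); have := ltn_ord k; lia.
pose c j := ((a + j)`! * (b + r.-1 - j)`!)%:R : int.
have -> : (fact_run a r * fact_run b r)%:R = \prod_(j < r) c j :> int.
  by rewrite (revE b) /fact_run -big_split natr_prod.
have -> : \prod_(j < r) c j = \det (diag_mx (\row_(j < r) c j)).
  by rewrite det_diag; apply: eq_bigr => j _; rewrite mxE.
rewrite -det_mulmx.
have -> : box_mx int a b r *m diag_mx (\row_(j < r) c j) =
    (a + b)`!%:R *: \matrix_(i, j < r) (P i).[j%:R].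
  apply/matrixP => i j; rewrite mul_mx_diag !mxE PE /c.
  rewrite -!natrD [(j + a)%N]addnC prod_ffact.
  have ir := ltn_ord i; have jr := ltn_ord j.
  have -> : (b + r.-1)%N%:R - j%:R = (b + r.-1 - j)%N%:R :> int by rewrite natrB //; lia.
  rewrite prod_ffact -!natrM; congr (_%:R).
  case: leqP => [le|lt]; last by rewrite mul0n ffact_small // mul0n muln0.
  have [le2|lt2] := leqP (a + j - i) (a + b).
    rewrite -(ffact_fact le) -(bin_fact le2).
    have le3 : (r.-1 - i <= b + r.-1 - j)%N by lia.
    rewrite -(ffact_fact le3).
    have -> : (b + r.-1 - j - (r.-1 - i) = a + b - (a + j - i))%N by lia.
    by ring.
  by rewrite bin_small // mul0n [X in (_ * (_ * X))%N]ffact_small ?muln0 //; lia.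
rewrite detZ -(det_horner_translate (- a%:R) sP) -det_tr det_trig; last first.
  apply/is_trig_mxP => i j ij; rewrite !mxE PE subrK prod_ffact ffact_small //.
  by rewrite mul0r.
rewrite (revE (a + b)%N) /fact_run -big_split natr_prod /=.
rewrite -[X in _ ^+ X](card_ord r) -prodr_const -big_split; apply: eq_bigr => k _ /=.
rewrite !mxE PE subrK prod_ffact ffactnn add0n.
have kr := ltn_ord k.
have -> : b%:R + r.-1%:R - (k%:R - a%:R) = (a + b + r.-1 - k)%N%:R :> int.
  by rewrite natrB ?natrD; [ring|lia].
rewrite prod_ffact -!natrM; congr (_%:R).
have le : (r.-1 - k <= a + b + r.-1 - k)%N by lia.
rewrite -(ffact_fact le); have -> : (a + b + r.-1 - k - (r.-1 - k) = a + b)%N by lia.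
by ring.
Qed.

(** * Powers of [x + y] *)

Lemma box_mx_unit (K : fieldType) (p a b r : nat) : p \in [pchar K] ->
  (box_mx K a b r \in unitmx) =
  (logn p (fact_run a r * fact_run b r) == logn p (fact_run 0 r * fact_run (a + b) r)).
Proof.
move=> charK; have pp := pcharf_prime charK.
have -> : box_mx K a b r = map_mx intr (box_mx int a b r).
  by apply/matrixP => i j; rewrite !mxE mulrz_nat.
rewrite unitmxE det_map_mx unitfE.
have := det_box_mx a b r.
set A := (fact_run a r * _)%N; set B := (fact_run 0 r * _)%N.
have A0 : (0 < A)%N by rewrite muln_gt0 !fact_run_gt0.
have B0 : (0 < B)%N by rewrite muln_gt0 !fact_run_gt0.
move: (\det _) => D; rewrite !natz => DE.
have [d dE] : exists d : nat, D = d%:Z by case: D DE => d DE; [exists d|lia].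
rewrite dE in DE *; have {}DE : (d * A = B)%N by lia.
have d0 : (0 < d)%N by case: d DE {dE} => //; lia.
rewrite -DE lognM // -[X in _ = (X == _)]add0n eqn_add2r.
rewrite -[X in X != 0]/(d%:~R : K) -pmulrn -(dvdn_pcharf charK).
by have := pfactor_dvdn 1 pp d0; rewrite expn1 => ->; rewrite lt0n negbK eq_sym.
Qed.

Lemma sum_shift_support (V : nmodType) (h : nat -> V) a k L : (a + k <= L)%N ->
  (forall u, ~~ (a <= u < a + k)%N -> h u = 0) ->
  \sum_(s < k) h (a + s)%N = \sum_(u < L) h u.
Proof.
move=> akL h0; rewrite -(big_mkord xpredT h).
have a0 : (0 <= a)%N by []; have aL : (a <= L)%N by lia.
rewrite (big_cat_nat a0 aL) /= (big_cat_nat (leq_addr k a) akL) /=.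
rewrite [X in X + _]big_nat_cond [X in X + _]big1 ?add0r; last by move=> u hu; apply: h0; lia.
rewrite [X in _ + X]big_nat_cond [X in _ + X]big1 ?addr0; last by move=> u hu; apply: h0; lia.
rewrite -{2}[a]add0n [(a + k)%N]addnC big_addn addnK big_mkord.
by apply: eq_bigr => s _; rewrite addnC.
Qed.

Section Strings.

Variables (K : fieldType) (N m n : nat) (X : 'M[K]_N) (F : nat -> nat -> 'rV[K]_N).
Hypotheses (m_gt0 : (0 < m)%N) (m_le_n : (m <= n)%N).
Hypothesis F_out : forall i j, (m <= i)%N || (n <= j)%N -> F i j = 0.
Hypothesis F_step : forall i j, F i j *m X = F i.+1 j + F i j.+1.
Hypothesis F_span : forall S : 'M[K]_N, (forall i j, F i j <= S)%MS -> (1%:M <= S)%MS.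

Lemma family_pow i j k :
  F i j *m X ^+ k = \sum_(s < k.+1) F (i + s) (j + (k - s)) *+ 'C(k, s).
Proof.
elim: k i j => [|k IH] i j.
  by rewrite expr0 big_ord1 bin0 addn0 mulmx1 addn0.
rewrite exprS mulmxA F_step mulmxDl !IH [RHS]big_ord_recl bin0 subn0 addn0 /=.
rewrite [X in _ = _ + X](eq_bigr (fun s : 'I_k.+1 =>
  F (i.+1 + s) (j + (k - s)) *+ 'C(k, s) + F (i.+1 + s) (j + (k - s)) *+ 'C(k, s.+1))).
  rewrite big_split addrCA; congr (_ + _).
  rewrite [LHS]big_ord_recl [X in _ = _ + X]big_ord_recr /= (bin_small (ltnSn k)) mulr0n addr0.
  rewrite bin0 subn0 addn0 addSnnS; congr (_ + _); apply: eq_bigr => s _.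
  by have := ltn_ord s => sk; congr (F _ _ *+ _); rewrite /bump; lia.
by move=> s _; rewrite /bump add1n subSS binS mulrnDr addrC addSnnS.
Qed.

Definition low_mx (d : nat) : 'M[K]_(d.+1, N) := \matrix_(i < d.+1) F i (d - i).
Definition high_mx (d : nat) : 'M[K]_(d.+1, N) :=
  \matrix_(j < d.+1) F (m.-1 - d + j) (n.-1 - j).

Lemma family_low i j : (F i j <= low_mx (i + j))%MS.
Proof.
have lt : (i < (i + j).+1)%N by lia.
have -> : F i j = row (Ordinal lt) (low_mx (i + j)) by rewrite rowK /= addKn.
exact: row_sub.
Qed.

Lemma family_high i j d : (d < m)%N -> (i + j + d = m + n - 2)%N -> (F i j <= high_mx d)%MS.
Proof.
move=> dm e; have [out|] := boolP ((m <= i)%N || (n <= j)%N).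
  by rewrite F_out // sub0mx.
rewrite negb_or -!ltnNge => /andP[im jn].
have lt : (i - (m.-1 - d) < d.+1)%N by lia.
have -> : F i j = row (Ordinal lt) (high_mx d) by rewrite rowK /=; congr F; lia.
exact: row_sub.
Qed.

Lemma family_pow_sub r (S : 'M[K]_(r, N)) i j k :
  (forall i' j', (i' + j' = i + j + k)%N -> (F i' j' <= S)%MS) -> (F i j *m X ^+ k <= S)%MS.
Proof.
move=> h; rewrite family_pow summx_sub // => s _; rewrite -scaler_nat scalemx_sub //.
by apply: h; have := ltn_ord s; lia.
Qed.

Lemma low_mx_pow d : (d < m)%N ->
  low_mx d *m X ^+ (m + n - 2 - 2 * d) =
  box_mx K (m.-1 - d) (n.-1 - d) d.+1 *m high_mx d.
Proof.
move=> dm; apply/row_matrixP => i; rewrite row_mul rowK family_pow.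
have ir := ltn_ord i.
pose h u := if (i <= u)%N then
  F u (m + n - 2 - d - u) *+ 'C(m + n - 2 - 2 * d, u - i) else 0.
transitivity (\sum_(u < m + n) h u).
  rewrite -(@sum_shift_support _ h i (m + n - 2 - 2 * d).+1); first last.
  - move=> u hu; rewrite /h; case: leqP => // iu.
    by rewrite bin_small ?mulr0n //; lia.
  - by lia.
  apply: eq_bigr => s _; have sr := ltn_ord s; rewrite /h leq_addr addKn.
  by congr (F _ _ *+ _); lia.
rewrite -(@sum_shift_support _ h (m.-1 - d) d.+1); first last.
- move=> u hu; rewrite /h; case: leqP => // iu.
  by rewrite F_out ?mul0rn //; lia.
- by lia.
rewrite row_mul mulmx_sum_row; apply: eq_bigr => j _; have jr := ltn_ord j.
rewrite rowK !mxE /h; case: leqP => _; last by rewrite scale0r.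
rewrite scaler_nat; congr (F _ _ *+ 'C(_, _)); lia.
Qed.

Lemma rank_pow_le d : (d < m)%N ->
  (\rank (X ^+ (m + n - 2 - 2 * d)) <=
   d * d.+1 + \rank (box_mx K (m.-1 - d) (n.-1 - d) d.+1))%N.
Proof.
move=> dm; set c := (m + n - 2 - 2 * d)%N.
pose A : 'M[K]_N := (\sum_(e < d) <<low_mx e *m X ^+ c>>)%MS.
pose B : 'M[K]_N := <<low_mx d *m X ^+ c>>%MS.
pose C : 'M[K]_N := (\sum_(e < d) <<high_mx e>>)%MS.
have sub : (X ^+ c <= A + B + C)%MS.
  have full : (1%:M <= \sum_(u < m) \sum_(v < n) <<F u v>>)%MS.
    apply: F_span => i j; have [out|] := boolP ((m <= i)%N || (n <= j)%N).
      by rewrite F_out // sub0mx.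
    rewrite negb_or -!ltnNge => /andP[im jn].
    by apply: (sumsmx_sup (Ordinal im)) => //; apply: (sumsmx_sup (Ordinal jn)); rewrite ?genmxE.
  rewrite -[X ^+ c]mul1mx; apply: submx_trans (submxMr _ full) _.
  rewrite sumsmxMr; apply/sumsmx_subP => i _; rewrite sumsmxMr; apply/sumsmx_subP => j _.
  rewrite (eqmxMr _ (genmxE _)).
  case: (ltngtP (i + j) d) => ijd.
  - apply: submx_trans (addsmxSl _ _); apply: submx_trans (addsmxSl _ _).
    apply: (sumsmx_sup (Ordinal ijd)) => //; rewrite genmxE submxMr //; exact: family_low.
  - apply: submx_trans (addsmxSr _ _); apply: family_pow_sub => i' j' e.
    have [out|] := boolP ((m <= i')%N || (n <= j')%N).
      by rewrite F_out // sub0mx.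
    rewrite negb_or -!ltnNge => /andP[im jn].
    have lt : (m + n - 2 - (i' + j') < d)%N by lia.
    by apply: (sumsmx_sup (Ordinal lt)) => //; rewrite genmxE family_high //=; lia.
  apply: submx_trans (addsmxSl _ _); apply: submx_trans (addsmxSr _ _).
  by rewrite genmxE submxMr // -ijd family_low.
apply: leq_trans (mxrankS sub) _; apply: leq_trans (mxrank_adds_leqif _ _).1 _.
have rC : (\rank C <= \sum_(e < d) e.+1)%N.
  apply: leq_trans (mxrank_sum_leqif _).1 _; apply: leq_sum => e _.
  by rewrite /= genmxE rank_leq_row.
have rA : (\rank A <= \sum_(e < d) e.+1)%N.
  apply: leq_trans (mxrank_sum_leqif _).1 _; apply: leq_sum => e _.
  by rewrite /= genmxE rank_leq_row.
have rB : (\rank B <= \rank (box_mx K (m.-1 - d) (n.-1 - d) d.+1))%N.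
  by rewrite /B genmxE low_mx_pow // mxrankM_maxl.
have s2 : (\sum_(e < d) e.+1 + \sum_(e < d) e.+1 = d * d.+1)%N.
  by elim: (d) => [|k IH]; rewrite ?big_ord0 // !big_ord_recr /=; move: IH; set u := (\sum_(e < k) _)%N; nia.
apply: leq_trans (leq_add (leq_trans (mxrank_adds_leqif _ _).1 (leq_add rA rB)) rC) _.
by rewrite addnAC s2.
Qed.

Lemma stable_pow (S : 'M[K]_N) k : (S *m X <= S)%MS -> (S *m X ^+ k <= S)%MS.
Proof.
move=> SX; elim: k => [|k IH]; first by rewrite expr0 mulmx1.
by rewrite exprS mulmxA; apply: submx_trans (submxMr _ SX) IH.
Qed.

Hypothesis box_unit : forall d, (d < m)%N -> box_mx K (m.-1 - d) (n.-1 - d) d.+1 \in unitmx.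

Lemma high_sub_low d : (d < m)%N ->
  (high_mx d <= low_mx d *m X ^+ (m + n - 2 - 2 * d))%MS.
Proof.
move=> dm; rewrite low_mx_pow //.
by rewrite -{1}[high_mx d](mulKmx (box_unit dm)) submxMl.
Qed.

(* For [d > 0], [F d 0 X ^ (c + 1)] with [c = m + n - 2 - 2 d] has degree
   [m + n - 2 - (d - 1)], where it is also [y X ^ (c + 2)] for some [y] of degree [d - 1];
   then [v = F d 0 - y X]. *)
Lemma string_head d : (d < m)%N -> exists v : 'rV[K]_N,
  v *m X ^+ (m + n - 1 - 2 * d) = 0 /\
  forall S : 'M[K]_N, (S *m X <= S)%MS -> (v <= S)%MS ->
    (forall i j, (i + j < d)%N -> (F i j <= S)%MS) -> (F d 0 <= S)%MS.
Proof.
case: d => [_|d dm].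
  exists (F 0 0); split=> //; apply/eqP; rewrite -submx0.
  by apply: family_pow_sub => i j e; rewrite F_out ?sub0mx //; lia.
have sub : (F d.+1 0 *m X ^+ (m + n - 1 - 2 * d.+1) <=
    low_mx d *m X ^+ (m + n - 2 - 2 * d))%MS.
  apply: submx_trans (high_sub_low (ltnW dm)).
  by apply: family_pow_sub => i j e; apply: family_high; lia.
have [w wE] := submxP sub.
have cE : (m + n - 2 - 2 * d = (m + n - 1 - 2 * d.+1).+1)%N by lia.
exists (F d.+1 0 - w *m low_mx d *m X); split.
  by rewrite mulmxBl wE cE exprS !mulmxA subrr.
move=> S SX vS lowS; rewrite -[F _ _](subrK (w *m low_mx d *m X)) addmx_sub //.
apply: submx_trans (submxMr _ _) SX; apply: submx_trans (submxMl _ _) _.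
by apply/row_subP => i; rewrite rowK lowS //; have := ltn_ord i; lia.
Qed.

Lemma string_heads : exists v : 'I_m -> 'rV[K]_N,
  (forall d, v d *m X ^+ (m + n - 1 - 2 * d) = 0) /\
  forall S : 'M[K]_N, (S *m X <= S)%MS -> (forall d, v d <= S)%MS -> (1%:M <= S)%MS.
Proof.
have [v vP] := fin_all_exists (fun d : 'I_m => string_head (ltn_ord d)).
exists v; split=> [d|S SX vS]; first exact: (vP d).1.
have lowS e : (e < n)%N -> forall i j, (i + j = e)%N -> (F i j <= S)%MS.
  elim/ltn_ind: e => e IH en i; have [k kE] := ubnP (m - i)%N.
  elim: k i kE => // k IHk i kE j ijE.
  have [im|im] := leqP m i; first by rewrite F_out ?im ?sub0mx.
  case: j ijE => [|j] ijE.
    apply: ((vP (Ordinal im)).2 S SX (vS _)) => i' j' /= lt.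
    by apply: (IH (i' + j')%N) => //; lia.
  have -> : F i j.+1 = F i j *m X - F i.+1 j by rewrite F_step addrC addKr.
  rewrite addmx_sub ?eqmx_opp //; last by apply: IHk; lia.
  by apply: submx_trans (submxMr _ _) SX; apply: (IH (i + j)%N) => //; lia.
apply: F_span => i j; have [lt|ge] := ltnP (i + j) n; first exact: lowS lt _ _ _.
have [out|] := boolP ((m <= i)%N || (n <= j)%N); first by rewrite F_out // sub0mx.
rewrite negb_or -!ltnNge => /andP[im jn].
set d := (m + n - 2 - (i + j))%N; have dm : (d < m)%N by lia.
apply: submx_trans (family_high dm _) _; first by lia.
apply: submx_trans (high_sub_low dm) _.
apply: submx_trans (submxMr _ _) (stable_pow _ SX).
by apply/row_subP => k; rewrite rowK (lowS d) //; have := ltn_ord k; lia.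
Qed.

End Strings.

(** * Representations of cyclic groups *)

Section Tensor.
Variable K : fieldType.

Lemma trow_tprod m n m' n' (u : 'rV[K]_m) (w : 'rV[K]_n)
    (A : 'M[K]_(m, m')) (B : 'M[K]_(n, n')) :
  trow u w *m tprod A B = trow (u *m A) (w *m B).
Proof.
have usub k (x : 'M[K]_(1 + 0, k)) : usubmx x = x.
  by apply/matrixP => i j; rewrite mxE; congr (x _ _); apply: val_inj.
have := congr1 (@usubmx K 1 0 (m' * n')) (tprodE u A w B).
by rewrite usumx_mul /= !col_mxKu !usub => <-.
Qed.

Lemma trow_ind m n (P : 'rV[K]_(m * n) -> Prop) :
  (forall x y, P x -> P y -> P (x + y)) -> P 0 ->
  (forall (u : 'rV_m) (w : 'rV_n), P (trow u w)) -> forall z, P z.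
Proof.
elim: m P => [|m IH] P PD P0 Pt z.
  have -> : z = trow (0 : 'rV[K]_0) (0 : 'rV[K]_n) by rewrite [LHS]thinmx0 [RHS]thinmx0.
  exact: Pt.
rewrite -[z](@hsubmxK K 1 n (m * n)).
have -> : row_mx (lsubmx z) (rsubmx z) = row_mx (lsubmx z) 0 + row_mx 0 (rsubmx z).
  by rewrite add_row_mx addr0 add0r.
apply: (PD).
  have := Pt (row_mx (1%:M : 'M_1) (0 : 'rV_m)) (lsubmx z).
  by rewrite /= row_mxKl row_mxKr trow0 mxE eqxx scale1r.
move: (rsubmx z); apply: (IH (fun b => P (row_mx 0 b))).
- by move=> x y Px Py; have := PD _ _ Px Py; rewrite add_row_mx addr0.
- by rewrite row_mx0.
move=> u w; have := Pt (row_mx (0 : 'M_1) u) w.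
by rewrite /= row_mxKl row_mxKr mxE scale0r.
Qed.

End Tensor.

Section CyclicRepresentations.

Variables (K : fieldType) (gT : finGroupType) (G : {group gT}) (g : gT).
Hypothesis defG : G :=: <[g]>%g.

Local Notation nilp rG := (rG g - 1).

Let Gg : g \in G. Proof. by rewrite defG cycle_id. Qed.

Let gen x : x \in G -> exists i, x = (g ^+ i)%g.
Proof. by rewrite defG => /cycleP. Qed.

Lemma intertwines_gen d1 d2 (r1 : mx_representation K G d1) (r2 : mx_representation K G d2)
    (C : 'M[K]_(d1, d2)) :
  nilp r1 *m C = C *m nilp r2 -> forall x, x \in G -> r1 x *m C = C *m r2 x.
Proof.
rewrite mulmxBl mulmxBr mul1mx mulmx1 => /addIr hC x /gen[i ->].
elim: i => [|i IH]; first by rewrite !repr_mx1 mul1mx mulmx1.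
by rewrite expgS !repr_mxM ?groupX // -mulmxA IH !mulmxA hC.
Qed.

Lemma mxmodule_gen d (rG : mx_representation K G d) k (U : 'M[K]_(k, d)) :
  (U *m nilp rG <= U)%MS -> mxmodule rG U.
Proof.
move=> UX; apply/mxmoduleP => x /gen[i ->].
have Ug : (U *m rG g <= U)%MS.
  by rewrite -[rG g](subrK 1) mulmxDr mulmx1 addmx_sub.
elim: i => [|i IH]; first by rewrite repr_mx1 mulmx1.
by rewrite expgS repr_mxM ?groupX // mulmxA (submx_trans (submxMr _ Ug)).
Qed.

Lemma rsim_rank_pow d1 d2 (r1 : mx_representation K G d1) (r2 : mx_representation K G d2) c :
  mx_rsim r1 r2 -> \rank (nilp r1 ^+ c) = \rank (nilp r2 ^+ c).
Proof.
case=> B e; subst d2 => freeB hB.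
have hX : nilp r1 ^+ c *m B = B *m nilp r2 ^+ c.
  elim: c => [|c IH]; first by rewrite !expr0 mul1mx mulmx1.
  by rewrite !exprS -[_ * _ *m B]mulmxA IH !mulmxA mulmxBl mulmxBr mul1mx mulmx1 hB.
have fullB : row_full B by rewrite row_full_unit -row_free_unit.
by rewrite -(mxrankMfree _ freeB) hX (eqmxMfull _ fullB).
Qed.

Lemma nilp_pow_pchar p alpha d (rG : mx_representation K G d) :
  p \in [pchar K] -> #|G| = (p ^ alpha)%N -> nilp rG ^+ #|G| = 0.
Proof.
case: d rG => [|d] rG charK cardG; first by rewrite [LHS]thinmx0 [RHS]thinmx0.
have pX : ('X - 1 : {poly K}) ^+ #|G| = 'X ^+ #|G| - 1.
  have charX : p \in [pchar {poly K}] by rewrite pchar_poly.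
  have pn : [pchar {poly K}].-nat #|G|.
    rewrite cardG pnatX; apply/orP; left.
    by rewrite (eq_pnat _ (pcharf_eq charX)) pnat_id // (pcharf_prime charK).
  by have := exprDn_pchar ('X - 1) 1 pn; rewrite subrK expr1n => ->; rewrite addrK.
have := congr1 (horner_mx (rG g)) pX.
rewrite rmorphXn !rmorphB /= rmorphXn /= horner_mx_X rmorph1 => ->.
have -> : rG g ^+ #|G| = rG (g ^+ #|G|)%g.
  elim: #|G| => [|k IH]; first by rewrite expr0 repr_mx1.
  by rewrite exprS expgS repr_mxM ?groupX // IH.
by rewrite expg_cardG // repr_mx1 subrr.
Qed.

End CyclicRepresentations.

Definition krylov_mx (K : fieldType) d (X : 'M[K]_d) (u : 'rV[K]_d) r : 'M[K]_(r, d) :=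
  \matrix_(i < r) (u *m X ^+ i).

Lemma mulmx_expSr (K : fieldType) d (X : 'M[K]_d) k (A : 'M[K]_(k, d)) i :
  A *m X ^+ i.+1 = A *m X ^+ i *m X.
Proof. by rewrite exprSr mulmxA. Qed.

Lemma mulmx_exprD (K : fieldType) d (X : 'M[K]_d) k (A : 'M[K]_(k, d)) i j :
  A *m X ^+ i *m X ^+ j = A *m X ^+ (i + j).
Proof. by rewrite exprD mulmxA. Qed.

Lemma pow_eq0_le (K : fieldType) d (X : 'M[K]_d) i j : X ^+ i = 0 -> (i <= j)%N -> X ^+ j = 0.
Proof. by move=> X0 ij; rewrite -(subnKC ij) exprD X0 mul0r. Qed.

(* With [phi] a linear form such that [phi (u X ^ k) != 0], the complement [W] consists of
   the vectors [w] with [phi (w X ^ l) = 0] for all [l]. *)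
Lemma krylov_split (K : fieldType) d (X : 'M[K]_d) k :
    X ^+ k != 0 -> X ^+ k.+1 = 0 ->
  exists u : 'rV[K]_d, exists W : 'M[K]_d,
    [/\ row_free (krylov_mx X u k.+1), (W *m X <= W)%MS,
        (krylov_mx X u k.+1 + W :=: 1%:M)%MS & (krylov_mx X u k.+1 :&: W = 0)%MS].
Proof.
move=> Xk Xk1; have [i [j cij]] := matrix0Pn _ Xk.
pose u : 'rV[K]_d := delta_mx 0 i; pose phi : 'cV[K]_d := delta_mx j 0.
have uphi (A : 'M[K]_d) : (u *m A *m phi) 0 0 = A i j by rewrite -rowE -colE !mxE.
pose U := krylov_mx X u k.+1.
pose Phi : 'M[K]_(d, k.+1) := \matrix_(a, b) (X ^+ (k - b) *m phi) a 0.
have UPhi a b : (U *m Phi) a b = (X ^+ (a + (k - b))) i j.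
  rewrite -uphi exprD mulmxA -[in RHS]mulmxA mxE [RHS]mxE; apply: eq_bigr => l _.
  by rewrite !mxE.
have UPhi_unit : U *m Phi \in unitmx.
  rewrite unitmxE -det_tr det_trig; last first.
    apply/is_trig_mxP => a b ab; rewrite mxE UPhi.
    by rewrite (pow_eq0_le Xk1) ?mxE //; have := ltn_ord a; lia.
  rewrite unitfE; apply/prodf_neq0 => a _; rewrite mxE UPhi subnKC //.
  by have := ltn_ord a; lia.
have freeU : row_free U.
  by rewrite -row_leq_rank -{1}(mxrank_unit UPhi_unit) mxrankM_maxl.
exists u, (kermx Phi); have dxU : (U :&: kermx Phi = 0)%MS.
  apply/eqP; rewrite -submx0; apply/row_subP => a.
  have := row_sub a (U :&: kermx Phi)%MS; rewrite sub_capmx => /andP[/submxP[y ->]].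
  move/sub_kermxP; rewrite -mulmxA => /(congr1 (mulmx^~ (invmx (U *m Phi)))) /=.
  by rewrite mulmxK // mul0mx => ->; rewrite mul0mx sub0mx.
split=> //.
  apply/sub_kermxP; apply/matrixP => a b; rewrite [RHS]mxE -mulmxA.
  have kerPhi l : (kermx Phi *m (X ^+ l *m phi)) a 0 = 0.
    have [lk|kl] := leqP l k; last by rewrite (pow_eq0_le Xk1) // mul0mx mulmx0 mxE.
    have := mulmx_ker Phi; move/matrixP/(_ a (inord (k - l))); rewrite mxE [RHS]mxE => <-.
    rewrite mxE; apply: eq_bigr => s _; congr (_ * _).
    by rewrite [RHS]mxE inordK ?subKn //; lia.
  rewrite -(kerPhi (k - b).+1) mxE [RHS]mxE; apply: eq_bigr => s _; congr (_ * _).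
  rewrite exprS -mulmxA mxE [RHS]mxE; apply: eq_bigr => s' _; congr (_ * _).
  by rewrite mxE.
apply/eqmxP; rewrite submx1 /= sub1mx -col_leq_rank.
have := mxrank_sum_cap U (kermx Phi); rewrite dxU mxrank0 addn0 => ->.
rewrite (eqP freeU) mxrank_ker.
by have := rank_leq_col Phi; lia.
Qed.

Lemma count_gt_sum (s : seq nat) c :
  (\sum_(d <- s) (d - c) = \sum_(d <- s) (d - c.+1) + count (fun d => c < d) s)%N.
Proof.
elim: s => [|d s IH]; rewrite ?big_nil // !big_cons IH /=; lia.
Qed.

Lemma sorted_eq_sums (s s' : seq nat) :
    sorted geq s -> sorted geq s' -> all (leq 1) s -> all (leq 1) s' ->
    (forall c, \sum_(d <- s) (d - c) = \sum_(d <- s') (d - c))%N ->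
  s = s'.
Proof.
move=> sort_s sort_s' pos_s pos_s' e.
have geq_trans : transitive geq by move=> x y z xy yz; apply: leq_trans yz xy.
have geq_anti : antisymmetric geq by move=> x y /andP[xy yx]; apply/eqP; rewrite eqn_leq; apply/andP.
apply: (sorted_eq geq_trans geq_anti) => //.
apply/allP => x; rewrite mem_cat => hx.
have x1 : (1 <= x)%N by case/orP: hx; [apply: (allP pos_s)|apply: (allP pos_s')].
have cE r : count (fun d => x.-1 < d)%N r = (count_mem x r + count (fun d => x < d)%N r)%N.
  by elim: r => //= d r ->; lia.
have gt_eq c : count (fun d => c < d)%N s = count (fun d => c < d)%N s'.
  by apply/eqP; rewrite -(eqn_add2l (\sum_(d <- s) (d - c.+1))) -count_gt_sum e count_gt_sum e.
by rewrite /= -(eqn_add2r (count (fun d => x < d)%N s)) -cE !gt_eq cE.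
Qed.

Section JordanBlocks.

Variables (K : fieldType) (gT : finGroupType) (G : {group gT}) (g : gT).
Hypothesis defG : G :=: <[g]>%g.
Variables (p alpha : nat).
Hypotheses (charK : p \in [pchar K]) (cardG : #|G| = (p ^ alpha)%N).
Variable V : forall d : nat, mx_representation K G d.
Hypothesis V_indec : forall d : nat, (1 <= d <= #|G|)%N -> mx_indecomposable (V d).

Local Notation nilp rG := (rG g - 1).

Lemma indecomposable_block d : (1 <= d <= #|G|)%N ->
  nilp (V d) ^+ d = 0 /\ exists u : 'rV[K]_d, krylov_mx (nilp (V d)) u d \in unitmx.
Proof.
move=> hd; have [d0 indec] := V_indec hd.
set X := nilp (V d).
have exk : exists k, X ^+ k == 0.
  by exists #|G|; rewrite (nilp_pow_pchar defG (V d) charK cardG).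
have [k /eqP Xk kmin] := ex_minnP exk.
have k0 : (0 < k)%N.
  case: k Xk kmin => // /eqP X0 _; move: X0; rewrite expr0 => /eqP/matrixP.
  by move=> /(_ (Ordinal d0) (Ordinal d0)) /eqP; rewrite !mxE eqxx oner_eq0.
case: k k0 Xk kmin => // k _ Xk1 kmin.
have Xk : X ^+ k != 0 by apply/negP => /kmin; rewrite ltnn.
have [u [W [freeU WX sum1 cap0]]] := krylov_split Xk Xk1.
set U := krylov_mx X u k.+1 in freeU sum1 cap0.
have UX : (U *m X <= U)%MS.
  apply/row_subP => i; rewrite row_mul rowK -mulmx_expSr.
  have [lt|ge] := ltnP i.+1 k.+1; last by rewrite (pow_eq0_le Xk1 ge) mulmx0 sub0mx.
  have -> : u *m X ^+ i.+1 = row (Ordinal lt) U by rewrite rowK.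
  exact: row_sub.
have UW0 : <<U>>%MS = 0 \/ W = 0.
  apply: indec.
  - by apply: (mxmodule_gen defG); rewrite (eqmxMr _ (genmxE U)) genmxE.
  - exact: (mxmodule_gen defG).
  - by apply: eqmx_trans sum1; apply: adds_eqmx => //; apply: genmxE.
  by apply/mxdirect_addsP; apply/eqP; rewrite -submx0 -cap0 capmxS ?genmxE.
have W0 : W = 0.
  case: UW0 => // U0; move: freeU.
  by rewrite /row_free -(genmxE U) U0 mxrank0.
have dk : d = k.+1.
  have rkd : \rank (U + W)%MS = d by rewrite sum1 mxrank1.
  by move: rkd; rewrite W0 addsmx0 (eqP freeU).
by subst d; split=> //; exists u; rewrite -row_free_unit.
Qed.

Lemma block_hom d N (rG : mx_representation K G N) (v : 'rV[K]_N) :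
    (1 <= d <= #|G|)%N -> v *m nilp rG ^+ d = 0 ->
  exists C : 'M[K]_(d, N),
    (forall x, x \in G -> V d x *m C = C *m rG x) /\ (v <= C)%MS.
Proof.
move=> hd v0; have [Xd [u Uu]] := indecomposable_block hd.
set X := nilp (V d) in Xd Uu; set U := krylov_mx X u d in Uu.
pose C := invmx U *m krylov_mx (nilp rG) v d.
have UC : U *m C = krylov_mx (nilp rG) v d by rewrite mulKVmx.
have uC i : (i <= d)%N -> u *m X ^+ i *m C = v *m nilp rG ^+ i.
  rewrite leq_eqVlt => /predU1P[->|lt]; first by rewrite Xd mulmx0 mul0mx v0.
  by move/row_matrixP/(_ (Ordinal lt)): UC; rewrite row_mul !rowK.
exists C; split; last first.
  have d0 : (0 < d)%N by lia.
  by have := uC 0 (ltnW d0); rewrite !expr0 !mulmx1 => <-; apply: submxMl.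
apply: (intertwines_gen defG); apply: (can_inj (mulKmx Uu)).
apply/row_matrixP => i; rewrite !row_mul rowK.
have := uC i.+1 (ltn_ord i); have := uC i (ltnW (ltn_ord i)).
by rewrite !exprSr !mulmxA => ->.
Qed.

Lemma rank_block_pow d c : (1 <= d <= #|G|)%N -> \rank (nilp (V d) ^+ c) = (d - c)%N.
Proof.
move=> hd; have [Xd [u Uu]] := indecomposable_block hd.
set X := nilp (V d) in Xd Uu *; set U := krylov_mx X u d in Uu.
have fullU : row_full U by rewrite row_full_unit.
have freeU : row_free U by rewrite row_free_unit.
rewrite -(eqmxMfull _ fullU).
have lt (i : 'I_(d - c)) : (i + c < d)%N by have := ltn_ord i; lia.
pose P : 'M[K]_(d - c, d) := \matrix_(i < d - c) 'e_(Ordinal (lt i)).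
have PU : (U *m X ^+ c :=: P *m U)%MS.
  apply/eqmxP/andP; split; apply/row_subP => i; rewrite row_mul rowK.
    rewrite mulmx_exprD.
    have [hi|hi] := ltnP (i + c) d; last by rewrite (pow_eq0_le Xd hi) mulmx0 sub0mx.
    have hi' : (i < d - c)%N by lia.
    have -> : u *m X ^+ (i + c) = row (Ordinal hi') (P *m U).
      by rewrite row_mul rowK -rowE rowK.
    exact: row_sub.
  rewrite -rowE rowK /= -mulmx_exprD.
  have hi : (i < d)%N by have := ltn_ord i; lia.
  have -> : u *m X ^+ i *m X ^+ c = row (Ordinal hi) (U *m X ^+ c) by rewrite row_mul rowK.
  exact: row_sub.
rewrite PU mxrankMfree //; apply/eqP; rewrite -/(row_free P).
apply/row_freeP; exists P^T; apply/matrixP => i j.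
rewrite mxE (bigD1 (Ordinal (lt i))) //= big1 ?addr0.
  by rewrite !mxE !eqxx mul1r -!val_eqE /= eqn_add2r.
by move=> s ne; rewrite !mxE eqxx (negbTE ne) mul0r.
Qed.

Local Notation blocks s := (\big[@dadd_grepr K gT G/grepr0]_(d <- s) Representation (V d)).

Lemma blocks_degree s : rdegree (blocks s) = sumn s.
Proof. by elim: s => [|d s IH]; rewrite ?big_nil ?big_cons //= IH. Qed.

Lemma block_diag_pow d1 d2 (A : 'M[K]_d1) (B : 'M[K]_d2) c :
  block_mx A 0 0 B ^+ c = block_mx (A ^+ c) 0 0 (B ^+ c).
Proof.
elim: c => [|c IH]; first by rewrite !expr0 -scalar_mx_block.
by rewrite !exprS IH -[LHS]/(_ *m _) mulmx_block !mulmx0 !mul0mx !addr0 add0r.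
Qed.

Lemma rank_blocks_pow s c : all (fun d => 0 < d <= #|G|)%N s ->
  \rank (nilp (blocks s) ^+ c) = (\sum_(d <- s) (d - c))%N.
Proof.
elim: s => [|d s IH] /=; first by rewrite !big_nil [X in \rank X]flatmx0 mxrank0.
move=> /andP[hd /IH {}IH]; rewrite !big_cons -IH -(rank_block_pow c hd) /=.
rewrite -rank_diag_block_mx -block_diag_pow; congr (\rank (_ ^+ _)).
rewrite -[1 in LHS]/(1%:M) scalar_mx_block -[LHS]/(_ + - _) opp_block_mx add_block_mx.
by rewrite !oppr0 !addr0.
Qed.

Lemma blocks_hom (I : eqType) (s : seq I) (len : I -> nat) N
    (rG : mx_representation K G N) (v : I -> 'rV[K]_N) :
    (forall i, i \in s -> (1 <= len i <= #|G|)%N /\ v i *m nilp rG ^+ len i = 0) ->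
  exists C : 'M[K]_(rdegree (blocks (map len s)), N),
    (forall x, x \in G -> blocks (map len s) x *m C = C *m rG x) /\
    (forall i, i \in s -> (v i <= C)%MS).
Proof.
elim: s => [|i s IH] hs.
  by rewrite big_nil; exists 0; split=> [x _|//]; rewrite mul0mx mulmx0.
have [|C [homC vC]] := IH; first by move=> j js; apply: hs; rewrite inE js orbT.
have [hi vi] := hs i (mem_head _ _).
have [D [homD vD]] := block_hom hi vi.
rewrite /= big_cons; exists (col_mx D C); split=> [x Gx|j].
  by rewrite /= mul_block_col !mul0mx addr0 add0r homC // homD // mul_col_mx.
rewrite -addsmxE inE => /predU1P[->|/vC vjC].
  exact: submx_trans vD (addsmxSl _ _).
exact: submx_trans vjC (addsmxSr _ _).
Qed.

Lemma blocks_rsim (I : eqType) (s : seq I) (len : I -> nat) N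
    (rG : mx_representation K G N) (v : I -> 'rV[K]_N) :
    (forall i, i \in s -> (1 <= len i <= #|G|)%N /\ v i *m nilp rG ^+ len i = 0) ->
    (forall S : 'M[K]_N, (S *m nilp rG <= S)%MS -> (forall i, i \in s -> (v i <= S)%MS) ->
      (1%:M <= S)%MS) ->
    sumn (map len s) = N ->
  mx_rsim rG (blocks (map len s)).
Proof.
move=> hs span degN; have [C [homC vC]] := blocks_hom hs.
apply: mx_rsim_sym; have eN : rdegree (blocks (map len s)) = N by rewrite blocks_degree.
have fullC : row_full C.
  suff : (1%:M <= <<C>>)%MS by rewrite genmxE sub1mx.
  apply: span.
    rewrite (eqmxMr _ (genmxE C)) genmxE mulmxBr mulmx1 addmx_sub ?eqmx_opp //.
    by rewrite -homC ?submxMl //; have := cycle_id g; rewrite -defG.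
  by move=> i /vC; rewrite genmxE.
by exists C => //; rewrite /row_free (eqP fullC) eN.
Qed.

End JordanBlocks.

(** * The tensor product *)

Section TensorFamily.

Variables (K : fieldType) (gT : finGroupType) (G : {group gT}) (g : gT).
Hypothesis Gg : g \in G.
Variables (m n : nat) (r1 : mx_representation K G m) (r2 : mx_representation K G n).
Variables (u : 'rV[K]_m) (w : 'rV[K]_n).
Local Notation nilp rG := (rG g - 1).
Hypotheses (Xm : nilp r1 ^+ m = 0) (Yn : nilp r2 ^+ n = 0).
Hypotheses (u_unit : krylov_mx (nilp r1) u m \in unitmx).
Hypotheses (w_unit : krylov_mx (nilp r2) w n \in unitmx).

(* On [u X^i (x) w Y^j] the operator [g (x) g - 1] acts as [X + Y (1 + X)], where
   [1 + X = g (x) 1]; the factor [g ^ j] turns this into [X + Y]. *)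
Definition tensor_family (i j : nat) : 'rV[K]_(m * n) :=
  trow (u *m nilp r1 ^+ i *m r1 (g ^+ j)%g) (w *m nilp r2 ^+ j).

Lemma tensor_family_out i j : (m <= i)%N || (n <= j)%N -> tensor_family i j = 0.
Proof.
rewrite /tensor_family => /orP[mi|nj].
  by rewrite (pow_eq0_le Xm mi) mulmx0 mul0mx trow0.
by rewrite (pow_eq0_le Yn nj) mulmx0 linear0.
Qed.

Lemma tensor_family_step i j :
  tensor_family i j *m nilp (prod_repr r1 r2) = tensor_family i.+1 j + tensor_family i j.+1.
Proof.
rewrite mulmxBr mulmx1 /tensor_family /= trow_tprod.
have e2 : w *m nilp r2 ^+ j *m r2 g = w *m nilp r2 ^+ j + w *m nilp r2 ^+ j.+1.
  by rewrite mulmx_expSr mulmxBr mulmx1 [RHS]addrC subrK.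
have e1 : u *m nilp r1 ^+ i *m r1 (g ^+ j)%g *m r1 g =
    u *m nilp r1 ^+ i *m r1 (g ^+ j.+1)%g.
  by rewrite expgSr repr_mxM ?groupX // mulmxA.
have e3 : u *m nilp r1 ^+ i *m r1 (g ^+ j.+1)%g =
    u *m nilp r1 ^+ i *m r1 (g ^+ j)%g + u *m nilp r1 ^+ i.+1 *m r1 (g ^+ j)%g.
  rewrite expgS repr_mxM ?groupX // mulmx_expSr mulmxBr mulmx1 mulmxBl.
  by rewrite [RHS]addrC subrK mulmxA.
rewrite e1 e2 linearD /= addrAC; congr (_ + _).
by rewrite e3 -!trowbE linearD /= [LHS]addrAC subrr add0r.
Qed.

Lemma tensor_family_span (S : 'M[K]_(m * n)) :
  (forall i j, (tensor_family i j <= S)%MS) -> (1%:M <= S)%MS.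
Proof.
move=> hS.
have sub1 j (x : 'rV_m) : (trow x (w *m nilp r2 ^+ j) <= S)%MS.
  have rg : r1 (g ^+ j)%g \in unitmx by rewrite repr_mx_unit ?groupX.
  rewrite -[x](mulmxKV rg) -[x *m _](mulmxKV u_unit).
  move: (x *m _ *m _) => y; rewrite -trowbE [y *m _]mulmx_sum_row mulmx_suml linear_sum summx_sub //= => i _.
  by rewrite -scalemxAl linearZ /= scalemx_sub // trowbE rowK hS.
have sub2 (x : 'rV_m) (y : 'rV_n) : (trow x y <= S)%MS.
  rewrite -[y](mulmxKV w_unit); move: (y *m _) => z.
  rewrite mulmx_sum_row linear_sum summx_sub //= => j _.
  by rewrite linearZ /= scalemx_sub // rowK.
apply/row_subP => i; move: (row i _); apply: trow_ind => //.
  by move=> x y xS yS; apply: addmx_sub.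
exact: sub0mx.
Qed.

End TensorFamily.

Lemma sum_odd_desc k s : (2 * k <= s)%N -> (\sum_(i < k) (s - 1 - 2 * i) = k * (s - k))%N.
Proof.
elim: k => [|k IH] ks; first by rewrite big_ord0.
by rewrite big_ord_recr /= IH; lia.
Qed.

Lemma boxes_unit_standard_pairs (K : fieldType) p t m n : p \in [pchar K] ->
  odd p -> (1 <= t)%N -> (p ^ t <= m < p ^ t.+1)%N -> (m <= n)%N ->
  (forall d, (d < m)%N -> box_mx K (m.-1 - d) (n.-1 - d) d.+1 \in unitmx) <->
  standard_pairs p t (m%:Z, n%:Z).
Proof.
move=> charK op t1 hm mn; have pp := pcharf_prime charK.
have m0 : (0 < m)%N by have := expn_gt0 p t; have := prime_gt0 pp; lia.
rewrite standard_pairsE // -boxes_balanced_iff // -logn_boxes_balanced //.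
split=> [h [|d] dm|h d dm]; first by rewrite /fact_run !big_ord0.
  have := h d dm; rewrite (box_mx_unit _ _ _ charK) => /eqP.
  by rewrite -!subn1 -!subnDA !add1n.
by rewrite (box_mx_unit _ _ _ charK) -!subn1 -!subnDA !add1n h.
Qed.

Lemma standard_pairs_bound p t m n alpha : prime p -> odd p -> (1 <= t)%N ->
  (p ^ t <= m < p ^ t.+1)%N -> (m <= n)%N -> (n <= p ^ alpha)%N ->
  standard_pairs p t (m%:Z, n%:Z) -> (m + n - 1 <= p ^ alpha)%N.
Proof.
move=> pp op t1 hm mn nq /standard_pairsE[] // near _ lt _.
have p1 := prime_gt1 pp.
have q0 : (0 < p ^ t)%N by rewrite expn_gt0; lia.
have mq : (p ^ t < m)%N.
  rewrite ltn_neqAle; have /andP[-> _] := hm; rewrite andbT.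
  apply/eqP => mE; move: near; rewrite /near_half -mE modnn.
  have : (1 < p ^ t)%N by rewrite -{1}(expn0 p) ltn_exp2l.
  lia.
have ta : (t.+1 <= alpha)%N by rewrite -(ltn_exp2l _ _ p1); lia.
move: nq; rewrite -(subnKC ta) expnD; move: (p ^ (alpha - t.+1))%N => s nq.
have := divn_eq n.-1 (p ^ t.+1).
have : (n.-1 %/ p ^ t.+1 < s)%N by rewrite ltn_divLR ?expn_gt0 1?mulnC; lia.
move: (n.-1 %/ _)%N (n.-1 %% _)%N lt => k e lt ks nE.
have := leq_mul ks (leqnn (p ^ t.+1)); move: (p ^ t.+1)%N lt nE => Q lt nE.
by rewrite mulSn [(s * Q)%N]mulnC; lia.
Qed.

Section JordanPartition.

Variables (K : fieldType) (gT : finGroupType) (G : {group gT}) (g : gT).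
Hypothesis defG : G :=: <[g]>%g.
Variables (p alpha : nat).
Hypotheses (charK : p \in [pchar K]) (cardG : #|G| = (p ^ alpha)%N).
Variable V : forall d : nat, mx_representation K G d.
Hypothesis V_indec : forall d : nat, (1 <= d <= #|G|)%N -> mx_indecomposable (V d).
Variables m n : nat.
Hypotheses (m_gt0 : (0 < m)%N) (m_le_n : (m <= n)%N) (n_le_q : (n <= #|G|)%N).

Let X := prod_repr (V m) (V n) g - 1.

Lemma rank_jordan_partition lam c : is_jordan_partition V m n lam ->
  \rank (X ^+ c) = (\sum_(d <- lam) (d - c))%N.
Proof.
case=> _ lam_le sim; rewrite (rsim_rank_pow defG c sim).
exact: (rank_blocks_pow defG charK cardG V_indec).
Qed.

Lemma jordan_partition_unique lam lam' : is_jordan_partition V m n lam ->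
  is_jordan_partition V m n lam' -> lam = lam'.
Proof.
move=> lamP lamP'; have [sort_lam le_lam _] := lamP; have [sort_lam' le_lam' _] := lamP'.
apply: sorted_eq_sums => //.
- by apply: sub_all le_lam => d /andP[].
- by apply: sub_all le_lam' => d /andP[].
by move=> c; rewrite -!rank_jordan_partition.
Qed.

Lemma tensor_family_exists : exists F : nat -> nat -> 'rV[K]_(m * n),
  [/\ forall i j, (m <= i)%N || (n <= j)%N -> F i j = 0,
      forall i j, F i j *m X = F i.+1 j + F i j.+1
    & forall S : 'M[K]_(m * n), (forall i j, (F i j <= S)%MS) -> (1%:M <= S)%MS].
Proof.
have Gg : g \in G by have := cycle_id g; rewrite -defG.
have hm : (1 <= m <= #|G|)%N by rewrite m_gt0 (leq_trans m_le_n).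
have hn : (1 <= n <= #|G|)%N by rewrite (leq_trans m_gt0).
have [Xm [u u_unit]] := indecomposable_block defG charK cardG V_indec hm.
have [Yn [w w_unit]] := indecomposable_block defG charK cardG V_indec hn.
exists (tensor_family g (V m) (V n) u w); split.
- exact: (tensor_family_out u w Xm Yn).
- exact: (tensor_family_step Gg (V m) (V n) u w).
exact: (tensor_family_span Gg u_unit w_unit).
Qed.

Lemma standard_box_unit lam : is_jordan_partition V m n lam ->
    standard_partition m n lam ->
  forall d, (d < m)%N -> box_mx K (m.-1 - d) (n.-1 - d) d.+1 \in unitmx.
Proof.
move=> lamP std d dm; have [F [F_out F_step F_span]] := tensor_family_exists.
have std' i : (i < m)%N -> nth 0%N lam i = (m + n - 1 - 2 * i)%N.
  by move=> im; have := std i.+1 im; rewrite /=; lia.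
have size_lam : (m <= size lam)%N.
  rewrite leqNgt; apply/negP => lt.
  by have := std' m.-1 ltac:(lia); rewrite nth_default; lia.
rewrite -row_free_unit -row_leq_rank leqNgt; apply/negP => singular.
have := rank_pow_le m_gt0 m_le_n F_out F_step F_span dm.
rewrite (rank_jordan_partition _ lamP) (big_nth 0%N) big_mkord.
set c := (m + n - 2 - 2 * d)%N; apply/negP; rewrite -ltnNge.
have le : (d.+1 <= size lam)%N by lia.
rewrite -(subnKC le) big_split_ord /=.
have -> : (\sum_(i < d.+1) (nth 0 lam i - c) = d.+1 * (2 * d.+1 - d.+1))%N.
  rewrite -sum_odd_desc //; apply: eq_bigr => i _; have := ltn_ord i => id.
  by rewrite std' /c; lia.
by nia.
Qed.

Definition standard_list : seq nat :=
  map (fun i : 'I_m => (m + n - 1 - 2 * i)%N) (enum 'I_m).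

Lemma nth_standard_list i : (i < m)%N -> nth 0%N standard_list i = (m + n - 1 - 2 * i)%N.
Proof.
move=> im; rewrite (nth_map (Ordinal im)) ?size_enum_ord //.
by rewrite nth_enum_ord.
Qed.

Lemma box_unit_standard : (m + n - 1 <= #|G|)%N ->
    (forall d, (d < m)%N -> box_mx K (m.-1 - d) (n.-1 - d) d.+1 \in unitmx) ->
  is_jordan_partition V m n standard_list.
Proof.
move=> bound box_unit; have [F [F_out F_step F_span]] := tensor_family_exists.
have [v [v0 v_span]] := string_heads m_gt0 m_le_n F_out F_step F_span box_unit.
have len_le (i : 'I_m) : (0 < m + n - 1 - 2 * i <= #|G|)%N by have := ltn_ord i; lia.
split.
- apply/(sortedP 0%N) => i; rewrite size_map size_enum_ord => im.
  by rewrite !nth_standard_list /geq /=; lia.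
- by rewrite all_map; apply/allP => i _; apply: len_le.
apply: (blocks_rsim defG charK cardG V_indec (v := v)).
- by move=> i _; split; [exact: len_le|exact: v0].
- by move=> S SX vS; apply: v_span => // i; apply: vS; rewrite mem_enum.
rewrite sumnE big_map big_enum /= sum_odd_desc ?addKn //; lia.
Qed.

End JordanPartition.

Theorem theorem2 (p t m n alpha : nat) (K : fieldType) (gT : finGroupType)
    (G : {group gT}) (V : forall d : nat, mx_representation K G d)
    (p_prime : prime p) (p_odd : odd p) (t_ge1 : (1 <= t)%N)
    (charK : p \in [pchar K]%R)
    (cyclicG : cyclic G) (cardG : #|G| = (p ^ alpha)%N)
    (V_indec : forall d : nat, (1 <= d <= #|G|)%N -> mx_indecomposable (V d))
    (m_bounds : (p ^ t <= m < p ^ t.+1)%N) (n_ge_m : (m <= n)%N)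
    (n_le_q : (n <= p ^ alpha)%N) :
  standard_partition m n (jordan_partition V m n) <->
  standard_pairs p t (m%:Z, n%:Z)%R.
Proof.
have [g defG] := cyclicP cyclicG.
have m_gt0 : (0 < m)%N.
  by apply: leq_trans (proj1 (andP m_bounds)); rewrite expn_gt0 prime_gt0.
have n_le_G : (n <= #|G|)%N by rewrite cardG.
have unitP := boxes_unit_standard_pairs charK p_odd t_ge1 m_bounds n_ge_m.
rewrite /jordan_partition; split.
  case: xgetP => [lam _ lamP std|_ std].
    apply/unitP.
    exact: (standard_box_unit defG charK cardG V_indec m_gt0 n_ge_m n_le_G lamP std).
  by have := std 1%N m_gt0; rewrite nth_nil; lia.
move=> Sp; have /unitP box_unit := Sp.
have bound : (m + n - 1 <= #|G|)%N.
  by rewrite cardG; exact: standard_pairs_bound Sp.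
have lam0P := box_unit_standard defG charK cardG V_indec m_gt0 n_ge_m n_le_G bound box_unit.
rewrite (jordan_partition_unique defG charK cardG V_indec (xgetI [::] lam0P) lam0P).
by case=> [|i] // im; rewrite nth_standard_list //; lia.
Qed.
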